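(* Let $2\le n\le\kappa+1$ and $\ell=\binom{\kappa}{n-1}$. Let $B$ and $D$ be the matrices constructed below. Then the rows of $$D=\left[B,\,-B\ltimes W_{[\kappa^0,\kappa]}\ltimes W_{[\kappa,\kappa]},\,-B\ltimes W_{[\kappa,\kappa]}\ltimes W_{[\kappa,\kappa^2]},\,\dots,\,-B\ltimes W_{[\kappa^{n-2},\kappa]}\ltimes W_{[\kappa,\kappa^{n-1}]}\right]\in\mathbb R^{\kappa\ell\times n\kappa^n}$$ form a basis of the subspace $\mathcal K_{[n;\kappa]}\subseteq\mathbb R^{n\kappa^n}$ of (structure vectors of) skew-symmetric games.
   Context: Semi-tensor product: for $A\in\mathbb R^{m\times n}$, $B\in\mathbb R^{p\times q}$ and $t=\mathrm{lcm}(n,p)$, $A\ltimes B=(A\otimes I_{t/n})(B\otimes I_{t/p})$; associative, equal to the Kronecker product on column vectors. Swap matrix $W_{[m,n]}\in\mathbb R^{mn\times mn}$: the permutation matrix with $W_{[m,n]}(X\otimes Y)=Y\otimes X$ for $X\in\mathbb R^m,Y\in\mathbb R^n$ ($W_{[1,n]}=I_n$). $\delta_\kappa^j$ is the $j$-th column of $I_\kappa$. Construction: let $z^1,\dots,z^\ell$ be the strictly increasing tuples $(z_1<\dots<z_{n-1})$ with entries in $\{1,\dots,\kappa\}$, listed in lexicographic order. For $i=1,\dots,\ell$, $j=1,\dots,\kappa$ define the row vector $\eta^i_j\in\mathbb R^{\kappa^n}$ by $(\eta^i_j)^T=\delta_\kappa^j\otimes\sum_{\sigma\in\mathbf S_{n-1}}\mathrm{sgn}(\sigma)\,\delta_\kappa^{z^i_{\sigma(1)}}\otimes\cdots\otimes\delta_\kappa^{z^i_{\sigma(n-1)}}$,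 and let $B\in\mathbb R^{\kappa\ell\times\kappa^n}$ have rows $\eta^1_1,\dots,\eta^1_\kappa,\dots,\eta^\ell_1,\dots,\eta^\ell_\kappa$ in this order. Games: $G\in\mathcal G_{[n;\kappa]}$ has players $\{1,\dots,n\}$, each with strategies $\{1,\dots,\kappa\}$ (strategy $j$ identified with $\delta_\kappa^j$) and payoffs $c_i$; $V_i^c\in\mathbb R^{\kappa^n}$ is the row vector with $c_i(x_1,\dots,x_n)=V_i^c(x_1\otimes\cdots\otimes x_n)$, and $V_G=[V_1^c,\dots,V_n^c]\in\mathbb R^{n\kappa^n}$ identifies $\mathcal G_{[n;\kappa]}$ with $\mathbb R^{n\kappa^n}$. $G$ is skew-symmetric if for all $\sigma\in\mathbf S_n$, all $i$ and all profiles, $c_i(x_1,\dots,x_n)=\mathrm{sgn}(\sigma)c_{\sigma(i)}(x_{\sigma^{-1}(1)},\dots,x_{\sigma^{-1}(n)})$; $\mathcal K_{[n;\kappa]}$ is the subspace of their structure vectors. *)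

(* Defs.v *)
(* Kronecker product: [tensmx] (notation A *t B) from
   mathcomp-real-closed's mxtens.v, standard index convention
   (i1, i2) |-> i1 * p + i2 (0-based). All indices below are 0-based. *)
From HB Require Import structures.
From mathcomp Require Import all_boot all_order all_algebra all_fingroup.
From mathcomp Require Import mxtens.
Set Implicit Arguments. Unset Strict Implicit. Unset Printing Implicit Defensive.
Import Order.TTheory GRing.Theory Num.Theory.
Local Open Scope ring_scope.

Section Defs.
Variable R : realFieldType.

Lemma stp_dim_eq (n p : nat) : (p * (lcmn n p %/ p) = n * (lcmn n p %/ n))%N.
Proof.
by rewrite [LHS]mulnC [RHS]mulnC divnK ?dvdn_lcmr // divnK ?dvdn_lcml.
Qed.

Definition stp (m n p q : nat) (A : 'M[R]_(m, n)) (B : 'M[R]_(p, q)) :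
  'M[R]_(m * (lcmn n p %/ n), q * (lcmn n p %/ p)) :=
  (A *t (1%:M : 'M[R]_(lcmn n p %/ n)))
    *m castmx (stp_dim_eq n p, erefl) (B *t (1%:M : 'M[R]_(lcmn n p %/ p))).

(* W_[m,n] (delta_m^a (x) delta_n^b) = delta_n^b (x) delta_m^a, i.e. the
   permutation matrix with a 1 in row b*m+a, column a*n+b. *)
Definition swapmx (m n : nat) : 'M[R]_(m * n) :=
  \matrix_(r, c) ((r == ((c %% n) * m + c %/ n)%N :> nat)%:R).

(* delta_k^a, the a-th column of I_k (0-based; a < k in all uses) *)
Definition delta (k a : nat) : 'cV[R]_k := \col_(r < k) ((r == a :> nat)%:R).

Fixpoint kronf (k m : nat) : ('I_m -> nat) -> 'cV[R]_(k ^ m) :=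
  match m return ('I_m -> nat) -> 'cV[R]_(k ^ m) with
  | 0 => fun _ => const_mx 1
  | m'.+1 => fun f =>
      castmx (esym (expnS k m'), muln1 1)
        (delta k (f ord0) *t kronf k (fun i : 'I_m' => f (lift ord0 i)))
  end.

Fixpoint incr_seqs (k m lo : nat) : seq (seq nat) :=
  match m with
  | 0 => [:: [::]]
  | m'.+1 => flatten [seq [seq a :: s | s <- incr_seqs k m' a.+1]
                     | a <- iota lo (k - lo)]
  end.

Definition ztuple (k n i : nat) : seq nat := nth [::] (incr_seqs k n.-1 0) i.

Definition ell (k n : nat) : nat := 'C(k, n.-1).

Definition etaT (k n i j : nat) : 'M[R]_(k * k ^ n.-1, 1 * 1) :=
  delta k j *t
    (\sum_(s : 'S_(n.-1)) (-1) ^+ s *: kronf k (fun t => nth 0 (ztuple k n i) (s t))).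

(* the row vector eta^i_j in R^{k^n} (the dimensions agree whenever n >= 1) *)
Definition eta (k n i j : nat) : 'rV[R]_(k ^ n) := conform_mx 0 (etaT k n i j)^T.

Definition Bmx (k n : nat) : 'M[R]_(k * ell k n, k ^ n) :=
  \matrix_(r, c) eta k n (r %/ k)%N (r %% k)%N 0 c.

(* block t (0-based): block 0 is B, block t >= 1 is
   - B |x W_[k^(t-1),k] |x W_[k,k^t] (dimensions agree when 2 <= n <= k+1) *)
Definition Dblock (k n t : nat) : 'M[R]_(k * ell k n, k ^ n) :=
  if t == 0%N then Bmx k n
  else conform_mx 0
         (- stp (stp (Bmx k n) (swapmx (k ^ t.-1) k)) (swapmx k (k ^ t))).

Definition Dmx (k n : nat) : 'M[R]_(k * ell k n, n * k ^ n) :=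
  \matrix_(r, c) Dblock k n (mxtens_unindex c).1 r (mxtens_unindex c).2.

(* a game in G_[n;k]: payoffs c i x for player i : 'I_n and profile x *)
Definition profile (n k : nat) := {ffun 'I_n -> 'I_k}.

(* V_i^c: the row vector with c_i(x) = V_i^c (x_1 (x) ... (x) x_n) *)
Definition Vpay (n k : nat) (c : 'I_n -> profile n k -> R) (i : 'I_n) :
  'rV[R]_(k ^ n) :=
  \sum_(x : profile n k) c i x *: (kronf k (fun t => (x t : nat)))^T.

Definition Vgame (n k : nat) (c : 'I_n -> profile n k -> R) : 'rV[R]_(n * k ^ n) :=
  \row_j Vpay c (mxtens_unindex j).1 0 (mxtens_unindex j).2.

Definition skew_symmetric (n k : nat) (c : 'I_n -> profile n k -> R) : Prop :=
  forall (s : 'S_n) (i : 'I_n) (x : profile n k),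
    c i x = (-1) ^+ s * c (s i) [ffun t => x ((s^-1)%g t)].

Definition inK (n k : nat) (v : 'rV[R]_(n * k ^ n)) : Prop :=
  exists c : 'I_n -> profile n k -> R, skew_symmetric c /\ v = Vgame c.

End Defs.

(* Main.v *)
(* Write n = m + 1. Multiplying by W_[k^(t-1),k] |x W_[k,k^t] exchanges the strategies of players
   0 and t, so the r-th row of D is the game with c_0 = B_r and c_t(x) = - B_r(x o (0 t)).
   With r = i k + j, B_r(x) = [x_0 = j] det([x_(a+1) = z^i_b])_(a,b), which is alternating in the
   opponents of player 0; conjugating by transpositions (0 t) shows that each row is skew-symmetric.
   Conversely a skew-symmetric game is determined by c_0, since permutations carry any player to
   player 0, and c_0 is alternating in the opponents, hence determined by its values on the
   profiles (j, z^i) with z^i strictly increasing. On these profiles B_r is the Kronecker delta. *)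
Require Import Defs.
From HB Require Import structures.
From mathcomp Require Import all_boot all_order all_algebra all_fingroup.
From mathcomp Require Import mxtens ring.
Import Order.TTheory GRing.Theory Num.Theory.
Local Open Scope ring_scope.

(** * Enumeration of strictly increasing tuples *)

Lemma incr_seqs_recl (k m lo : nat) : (lo < k)%N ->
  incr_seqs k m.+1 lo =
    [seq lo :: s | s <- incr_seqs k m lo.+1] ++ incr_seqs k m.+1 lo.+1.
Proof. by move=> lok; rewrite /= -(subnSK lok). Qed.

Lemma incr_seqs_geq (k m lo : nat) : (k <= lo)%N -> incr_seqs k m.+1 lo = [::].
Proof. by rewrite -subn_eq0 /= => /eqP->. Qed.

(** Downward induction on the lower bound: [incr_seqs] at [lo] unfolds to its value at [lo.+1], and
    for nonempty tuples the list becomes empty once [lo] reaches [k]. *)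
Lemma incr_seqsS_ind (k : nat) (P : nat -> Prop) :
  (forall lo, (k <= lo)%N -> P lo) ->
  (forall lo, (lo < k)%N -> P lo.+1 -> P lo) -> forall lo, P lo.
Proof.
move=> P0 PS lo; have [d] := ubnP (k - lo)%N.
elim: d lo => // d IHd lo; rewrite ltnS => led.
have [/P0 // | lok] := leqP k lo.
by apply/PS/IHd => //; rewrite subnSK.
Qed.

(** Pascal's rule: a tuple either starts with [lo] or has all its entries above [lo]. *)
Lemma size_incr_seqs (k m lo : nat) : size (incr_seqs k m lo) = 'C(k - lo, m).
Proof.
elim: m lo => [|m IHm] lo; first by rewrite bin0.
elim/(incr_seqsS_ind k): lo => lo lok.
  by rewrite incr_seqs_geq // (eqP lok) bin0n.
by move=> IH; rewrite incr_seqs_recl // size_cat size_map IHm IH -(subnSK lok) binS addnC.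
Qed.

Lemma mem_incr_seqs (k m lo : nat) (s : seq nat) :
  (s \in incr_seqs k m lo) =
    [&& size s == m, sorted ltn s & all (fun a => lo <= a < k)%N s].
Proof.
elim: m lo s => [|m IHm] lo s; first by case: s.
apply/flatten_mapP/idP => [[a] | ].
  rewrite mem_iota => /andP[loa ak] /mapP[u]; rewrite IHm => /and3P[/eqP<- su /allP au] ->.
  have {}ak : (a < k)%N.
    (* Truncated subtraction empties the range when [k < lo], so the second case is
       contradictory. *)
    have [lok|/ltnW/eqP kl] := leqP lo k; first by rewrite subnKC in ak.
    by move: ak; rewrite kl addn0 ltnNge loa.
  rewrite /= eqxx loa ak /= path_min_sorted ?su //=.
    by apply/allP => b /au /andP[ab ->]; rewrite (leq_trans loa) // ltnW.
  by apply/allP => b /au /andP[].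
case: s => [|a u] //=; rewrite eqSS => /and3P[su pu /andP[/andP[loa ak] au]].
exists a.
  by rewrite mem_iota loa subnKC // (leq_trans loa) // ltnW.
apply: map_f; rewrite IHm su (path_sorted pu) /=.
have /allP aP := order_path_min ltn_trans pu.
by apply/allP => b bu; rewrite aP //; have /andP[] := allP au b bu.
Qed.

Lemma incr_seqs_uniq (k m lo : nat) : uniq (incr_seqs k m lo).
Proof.
elim: m lo => [|m IHm] // lo.
elim/(incr_seqsS_ind k): lo => lo lok; first by rewrite incr_seqs_geq.
move=> u; rewrite incr_seqs_recl // cat_uniq u map_inj_uniq ?IHm //; last by move=> ? ? [].
rewrite andbT; apply/hasPn => s; rewrite mem_incr_seqs => /and3P[_ _ /allP as_].
apply/mapP => -[v _ sE]; have := as_ lo.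
by rewrite sE mem_head ltnn => /(_ isT).
Qed.

(** * Base-[k] digits and the coordinates of profiles *)

Lemma mulD_lt (a b p q : nat) : (a < p -> b < q -> a * q + b < p * q)%N.
Proof.
move=> ap bq; rewrite (leq_trans (n := a.+1 * q)%N) ?leq_mul2r ?ap ?orbT //.
by rewrite mulSn addnC ltn_add2r.
Qed.

(** Horner's scheme, most significant digit first, to match the index convention of the Kronecker
    product. *)
Definition digits (k : nat) (s : seq nat) : nat := foldl (fun a d => a * k + d)%N 0%N s.

Lemma digits_foldl (k a : nat) (s : seq nat) :
  (foldl (fun a d => a * k + d) a s = a * k ^ size s + digits k s)%N.
Proof.
rewrite /digits; elim: s a => [|d s IHs] a /=; first by rewrite muln1 addn0.
by rewrite IHs [in RHS]IHs mul0n add0n mulnDl addnA expnS mulnA.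
Qed.

Lemma digits_cat (k : nat) (s t : seq nat) :
  (digits k (s ++ t) = digits k s * k ^ size t + digits k t)%N.
Proof. by rewrite {1}/digits foldl_cat digits_foldl. Qed.

Lemma digits_cons (k a : nat) (s : seq nat) :
  (digits k (a :: s) = a * k ^ size s + digits k s)%N.
Proof. by rewrite -cat1s digits_cat /digits /= mul0n. Qed.

Lemma digits_lt (k : nat) (s : seq nat) :
  all (fun a => a < k)%N s -> (digits k s < k ^ size s)%N.
Proof.
elim: s => // a s IHs /andP[ak /IHs sk]; rewrite digits_cons expnS.
exact: mulD_lt.
Qed.

Definition strategies (k m : nat) (y : 'I_m -> 'I_k) : seq nat := [seq y i : nat | i <- enum 'I_m].

Lemma size_strategies (k m : nat) (y : 'I_m -> 'I_k) : size (strategies k m y) = m.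
Proof. by rewrite size_map size_enum_ord. Qed.

Lemma strategies_lt (k m : nat) (y : 'I_m -> 'I_k) : all (fun a => a < k)%N (strategies k m y).
Proof. by apply/allP => _ /mapP[i _ ->]; apply: ltn_ord. Qed.

Lemma strategiesS (k m : nat) (y : 'I_m.+1 -> 'I_k) :
  strategies k m.+1 y = (y ord0 : nat) :: strategies k m (fun i => y (lift ord0 i)).
Proof. by rewrite /strategies enum_ordSl /= -map_comp. Qed.

Lemma nth_strategies (k m : nat) (y : 'I_m -> 'I_k) (i : 'I_m) : nth 0%N (strategies k m y) i = y i.
Proof. by rewrite (nth_map i) ?size_enum_ord // nth_ord_enum. Qed.

Lemma profile_index_subproof (k m : nat) (y : 'I_m -> 'I_k) :
  (digits k (strategies k m y) < k ^ m)%N.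
Proof. by rewrite -[X in (_ < _ ^ X)%N](size_strategies _ _ y) digits_lt ?strategies_lt. Qed.

(* The coordinate of x_1 (x) ... (x) x_m, i.e. the strategies read as base-k digits. *)
Definition profile_index (k m : nat) (y : 'I_m -> 'I_k) : 'I_(k ^ m) :=
  Ordinal (profile_index_subproof k m y).

Lemma profile_index_surj (k m : nat) (c : 'I_(k ^ m)) :
  exists y : profile m k, c = profile_index k m y.
Proof.
elim: m c => [|m IHm] c.
  (* Here [k] may be zero, so the strategies are built from the impossible index [i : 'I_0]. *)
  exists [ffun i => widen_ord (leq0n k) i].
  by apply/val_inj; rewrite /= /strategies enum_ord0; case: c => -[].
pose c' : 'I_(k * k ^ m) := cast_ord (expnS k m) c.
have [y Ey] := IHm (mxtens_unindex c').2.
exists [ffun i => oapp y (mxtens_unindex c').1 (unlift ord0 i)].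
apply/val_inj; rewrite /= strategiesS digits_cons size_strategies ffunE unlift_none /=.
rewrite [LHS](divn_eq c (k ^ m)); congr (_ + _)%N.
have -> : (c %% k ^ m = (mxtens_unindex c').2)%N by [].
rewrite Ey /=; congr digits; apply: eq_map => i /=.
by rewrite ffunE liftK.
Qed.

(** Quotient and remainder of the index by [k ^ m] are the leading digit and the number formed by
    the other digits, so the Kronecker product splits off its first factor. *)
Lemma kronf_profile_index (R : realFieldType) (k m : nat) (f : 'I_m -> nat) (y : 'I_m -> 'I_k) :
  kronf R k f (profile_index k m y) 0 = \prod_t (y t == f t :> nat)%:R.
Proof.
elim: m f y => [|m IHm] f y; first by rewrite mxE big_ord0.
rewrite big_ord_recl /= -IHm castmxE /= mxE mxE; congr (_ * _).
  rewrite /= strategiesS digits_cons size_strategies divnMDl; last first.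
    by rewrite expn_gt0 (leq_ltn_trans _ (ltn_ord (y ord0))).
  by rewrite divn_small ?addn0 // profile_index_subproof.
congr (kronf _ _ _ _ _); apply/val_inj => //=.
by rewrite strategiesS digits_cons size_strategies modnMDl modn_small // profile_index_subproof.
Qed.

Lemma Vpay_profile_index (R : realFieldType) (n k : nat) (c : 'I_n -> profile n k -> R) i
    (x : profile n k) :
  Vpay c i 0 (profile_index k n x) = c i x.
Proof.
rewrite summxE (bigD1 x) //= big1 ?addr0 => [|y yx].
  by rewrite mxE mxE kronf_profile_index big1 ?mulr1 // => t _; rewrite eqxx.
have [t yxt] : exists t, x t != y t.
  apply/existsP; rewrite -negb_forall; apply: contra yx => /forallP xy.
  by apply/eqP/ffunP => t; apply/esym/eqP.
by rewrite !mxE kronf_profile_index (bigD1 t) //= [(_ == _ :> nat)]val_eqE (negPf yxt) mul0r mulr0.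
Qed.

(** * Semi-tensor products with swap matrices and the blocks of D *)

(** Since [a * b] divides [N], the lcm is [N]: the identity factor attached to [A] has size 1, and
    the swap matrix tensored with an identity of size [q] is a permutation matrix. The product thus
    only relabels columns. Taking [r'], [c'] and [q] through equations on naturals avoids casts
    between dimensions. *)
Lemma stp_swapmxE (R : realFieldType) (p N a b : nat) (A : 'M[R]_(p, N))
    (r : 'I_(p * (lcmn N (a * b) %/ N))) (c : 'I_(a * b * (lcmn N (a * b) %/ (a * b))))
    (r' : 'I_p) (c' : 'I_N) (q : nat) :
  q = (lcmn N (a * b) %/ (a * b))%N ->
  (a * b %| N)%N -> (r' = r :> nat)%N ->
  (c' = ((c %/ q %% b) * a + c %/ q %/ b) * q + c %% q :> nat)%N ->
  stp A (swapmx R a b) r c = A r' c'.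
Proof.
move=> -> abN Er Ec; clear q.
have N_gt0 : (0 < N)%N := leq_ltn_trans (leq0n _) (ltn_ord c').
have EN : lcmn N (a * b) = N by apply/eqP; rewrite eqn_dvd dvdn_lcml dvdn_lcm dvdnn abN.
have E1 : (lcmn N (a * b) %/ N = 1)%N by rewrite EN divnn N_gt0.
have q_gt0 : (0 < lcmn N (a * b) %/ (a * b))%N.
  by rewrite EN divn_gt0 ?(dvdn_gt0 N_gt0 abN) ?(dvdn_leq N_gt0 abN).
set W := castmx (stp_dim_eq N (a * b), erefl) (swapmx R a b *t (1%:M)).
(* The only 1 in column [c] of [W] stands in row [c']. *)
have WE j : W j c = (j == c' :> nat)%:R.
  rewrite castmxE !mxE -natrM mulnb -val_eqE /=; congr (nat_of_bool _)%:R.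
  apply/andP/eqP => [[/eqP jE /eqP jE']|->]; first by rewrite Ec -jE -jE' -divn_eq.
  by rewrite Ec divnMDl // (divn_small (ltn_pmod c q_gt0)) addn0 eqxx modnMDl modn_mod eqxx.
have jP : (c' < N * (lcmn N (a * b) %/ N))%N by rewrite E1 muln1 ltn_ord.
rewrite mxE (bigD1 (Ordinal jP)) //= big1 => [|j jc].
  rewrite addr0 WE eqxx mulr1 mxE [X in _ * X]mxE -val_eqE /=.
  have md z : (z %% (lcmn N (a * b) %/ N) = 0)%N by rewrite E1 modn1.
  have dv z : (z %/ (lcmn N (a * b) %/ N) = z)%N by rewrite E1 divn1.
  by rewrite !md mulr1; congr (A _ _); apply/val_inj; rewrite /= dv.
by rewrite WE [(_ == _ :> nat)](_ : _ = (j == Ordinal jP)) // (negPf jc) mulr0.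
Qed.

(** The two swap matrices act as block exchanges of digits: first x0 u xt v becomes u xt x0 v, whose
    value is [c1], then u and xt are exchanged, giving xt u x0 v. The net effect is the
    transposition of x0 and xt. *)
Lemma digits_swap (k : nat) (x0 xt : nat) (u v : seq nat) :
  all (fun a => a < k)%N (x0 :: u ++ xt :: v) ->
  let t := (size u).+1 in
  let q1 := (k ^ size v)%N in let q2 := (k ^ (size v).+1)%N in
  let c := digits k (x0 :: u ++ xt :: v) in
  let c1 := ((c %/ q1 %% k ^ t * k + c %/ q1 %/ k ^ t) * q1 + c %% q1)%N in
  digits k (xt :: u ++ x0 :: v) =
   ((c1 %/ q2 %% k * k ^ t.-1 + c1 %/ q2 %/ k) * q2 + c1 %% q2)%N.
Proof.
move=> al t q1 q2 c.
move: al; rewrite /= all_cat /= => /and4P[x0k uk xtk vk].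
have k0 : (0 < k)%N by apply: leq_ltn_trans x0k.
have catE y w z : digits k (y :: u ++ w :: z) =
    ((y * k ^ t + (digits k u * k + w)) * k ^ size z + digits k z)%N.
  rewrite digits_cons digits_cat digits_cons size_cat /= -addSnnS expnD.
  rewrite -/t expnS; ring.
have dv : (digits k v < q1)%N by apply: digits_lt.
have du : (digits k u < k ^ size u)%N by apply: digits_lt.
have q1_gt0 : (0 < q1)%N by rewrite expn_gt0 k0.
have duk : (digits k u * k + xt < k ^ t)%N.
  by rewrite expnSr; apply: mulD_lt.
have -> : (c %/ q1 = x0 * k ^ t + (digits k u * k + xt))%N.
  by rewrite /c catE divnMDl // divn_small ?addn0.
have -> : (c %% q1 = digits k v)%N by rewrite /c catE modnMDl modn_small.
rewrite divnMDl ?expn_gt0 ?k0 // (divn_small duk) addn0 modnMDl (modn_small duk).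
set c1 := ((_ * k + x0) * q1 + _)%N.
have c1E : c1 = ((digits k u * k + xt) * q2 + (x0 * q1 + digits k v))%N.
  by rewrite /c1 /q2 expnS -/q1; ring.
have x0v : (x0 * q1 + digits k v < q2)%N.
  by rewrite /q2 expnS; apply: mulD_lt.
rewrite c1E divnMDl ?expn_gt0 ?k0 // (divn_small x0v) addn0.
rewrite (modnMDl _ _ q2) (modn_small x0v) modnMDl divnMDl //.
rewrite (modn_small xtk) (divn_small xtk) addn0.
rewrite catE /q2 -/q1 /t /= !expnS -/q1; ring.
Qed.

Lemma conform_mxE (T : Type) (m n m' n' : nat) (em : m' = m) (en : n' = n)
    (B : 'M[T]_(m, n)) (A : 'M[T]_(m', n')) i j :
  conform_mx B A i j = A (cast_ord (esym em) i) (cast_ord (esym en) j).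
Proof. by case: m / em B i; case: n / en j => j B i; rewrite conform_mx_id !cast_ord_id. Qed.

(** Both lcm's equal [k ^ n], so every dimension collapses to the expected one and the column
    relabelling can be applied twice. *)
Lemma Dblock_digits (R : realFieldType) (k : nat) (x0 xt : nat) (u v : seq nat)
    (n t : nat) (r : 'I_(k * ell k n)) (c c' : 'I_(k ^ n)) :
  let s := x0 :: u ++ xt :: v in
  size s = n -> t = (size u).+1 -> all (fun a => a < k)%N s ->
  c = digits k s :> nat -> c' = digits k (xt :: u ++ x0 :: v) :> nat ->
  Dblock R k n t r c = - Bmx R k n r c'.
Proof.
move=> s sn tE sk Ec Ec'; have t0 : (t == 0)%N = false by rewrite tE.
rewrite /Dblock t0.
have k_gt0 : (0 < k)%N by case/andP: sk => x0k _; apply: leq_ltn_trans x0k.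
have kX_gt0 i : (0 < k ^ i)%N by rewrite expn_gt0 k_gt0.
have nE : n = (t + (size v).+1)%N by rewrite -sn tE /= size_cat addSn addnS.
have nE1 : (k ^ n = k ^ t.-1 * k * k ^ (size v).+1)%N.
  by rewrite -expnSr nE expnD tE.
have l1 : lcmn (k ^ n) (k ^ t.-1 * k) = (k ^ n)%N.
  by apply/eqP; rewrite eqn_dvd dvdn_lcml dvdn_lcm dvdnn nE1 dvdn_mulr.
have q1E : ((k ^ (size v).+1) = lcmn (k ^ n) (k ^ t.-1 * k) %/ (k ^ t.-1 * k))%N.
  by rewrite l1 nE1 mulKn // muln_gt0 kX_gt0.
set N2 := (k ^ t.-1 * k * (lcmn (k ^ n) (k ^ t.-1 * k) %/ (k ^ t.-1 * k)))%N.
have N2E : (N2 = k ^ n)%N by rewrite /N2 -q1E -nE1.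
have nE2 : N2 = (k * k ^ t * k ^ (size v))%N.
  by rewrite N2E -expnS -expnD nE -addSnnS.
have l2 : lcmn N2 (k * k ^ t) = N2.
  by apply/eqP; rewrite eqn_dvd dvdn_lcml dvdn_lcm dvdnn nE2 dvdn_mulr.
have q2E : (k ^ (size v) = lcmn N2 (k * k ^ t) %/ (k * k ^ t))%N.
  by rewrite l2 nE2 mulKn // muln_gt0 k_gt0 kX_gt0.
have m1 : (k * ell k n * (lcmn (k ^ n) (k ^ t.-1 * k) %/ k ^ n) = k * ell k n)%N.
  by rewrite l1 divnn kX_gt0 muln1.
have N2_gt0 : (0 < N2)%N by rewrite N2E.
have m2 : (k * ell k n * (lcmn (k ^ n) (k ^ t.-1 * k) %/ k ^ n) *
    (lcmn N2 (k * k ^ t) %/ N2) = k * ell k n)%N.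
  by rewrite l2 divnn N2_gt0 muln1.
have n2 : (k * k ^ t * (lcmn N2 (k * k ^ t) %/ (k * k ^ t)) = k ^ n)%N.
  by rewrite -q2E -nE2.
(* As the dimensions agree, [conform_mx] returns the product and not its default 0. *)
rewrite (conform_mxE _ _ _ _ _ m2 n2) mxE; congr (- _).
set c2 := cast_ord _ c.
(* The intermediate column, reached after the rightmost swap matrix only. *)
pose c1 := ((c2 %/ k ^ size v %% k ^ t * k + c2 %/ k ^ size v %/ k ^ t) * k ^ size v
  + c2 %% k ^ size v)%N.
have c1P : (c1 < N2)%N.
  have cP : (c2 %/ k ^ size v < k * k ^ t)%N
    by rewrite ltn_divLR //; apply: leq_trans (ltn_ord c) _; rewrite -nE2 N2E.
  rewrite nE2 [in X in (_ < X)%N](mulnC k).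
  apply: mulD_lt; last exact: ltn_pmod.
  by apply: mulD_lt; [exact: ltn_pmod | rewrite ltn_divLR].
rewrite (stp_swapmxE _ _ _ _ _ _ _ _ (cast_ord (esym m1) r) (Ordinal c1P) _ q2E) //; last first.
  by rewrite nE2 dvdn_mulr.
rewrite (stp_swapmxE _ _ _ _ _ _ _ _ r c' _ q1E) //; first by rewrite nE1 dvdn_mulr.
rewrite Ec' (digits_swap k x0 xt u v sk) -/s -Ec -tE.
done.
Qed.

Lemma strategies_tperm (k m : nat) (x : profile m.+1 k) (t : 'I_m.+1) :
  t != ord0 ->
  exists u v,
   [/\ (t : nat) = (size u).+1,
    strategies k m.+1 x = (x ord0 : nat) :: u ++ (x t : nat) :: v &
    strategies k m.+1 (fun i => x (tperm ord0 t i)) = (x t : nat) :: u ++ (x ord0 : nat) :: v].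
Proof.
move=> t0; have t_gt0 : (0 < t)%N by rewrite lt0n.
set s := strategies _ _ _.
(* Without player 0, player [t] sits at position [t.-1]: the witnesses are the strategies of players
   1 to [t.-1] and of those after [t]. *)
exists (take t.-1 (behead s)), (drop t (behead s)).
have st : size s = m.+1 by apply: size_strategies.
have sE : s = (x ord0 : nat) :: behead s by rewrite /s strategiesS.
have tm : (t.-1 < size (behead s))%N by rewrite size_behead st -ltnS prednK.
have su : size (take t.-1 (behead s)) = t.-1 by rewrite size_takel // ltnW.
rewrite su prednK //; split=> //.
  rewrite -[(x t : nat)]nth_strategies -/s -{2}[(t : nat)]prednK //.
  rewrite -nth_behead -[X in drop X _](prednK t_gt0) -drop_nth // cat_take_drop -sE //.
apply: (@eq_from_nth _ 0%N) => [|i].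
  rewrite size_strategies /= size_cat su /= size_drop size_behead st /=.
  rewrite -[in LHS](subnKC (ltn_ord t)); move: (ltn_ord t) t_gt0.
  case: (nat_of_ord t) => // t' _ _ /=; by rewrite addnS.
rewrite size_strategies => im; rewrite (nth_strategies _ _ _ (Ordinal im)) /=.
case: i im => [|i] im /=.
  by rewrite (_ : Ordinal im = ord0) ?tpermL //; apply/val_inj.
rewrite nth_cat su; case: ltngtP => it.
- rewrite nth_take // nth_behead tpermD -?(nth_strategies k _ x (Ordinal im)) //.
  by rewrite -val_eqE /= neq_ltn -ltn_predRL it orbT.
- rewrite -(subnSK it) /= nth_drop nth_behead.
  rewrite tpermD // -?val_eqE /=; last by rewrite neq_ltn -[X in (X < _)%N](prednK t_gt0) ltnS it.
  rewrite -(nth_strategies k _ x (Ordinal im)) /=; congr nth.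
  by rewrite (prednK t_gt0) subnKC // -[X in (X <= _)%N](prednK t_gt0).
- by rewrite [in RHS]it subnn /= (_ : Ordinal im = t) ?tpermR //; apply/val_inj;
    rewrite /= it prednK.
Qed.

Lemma Dblock_profile_index (R : realFieldType) (k m : nat) (x : profile m.+1 k) (t : 'I_m.+1) r :
  t != ord0 ->
  Dblock R k m.+1 t r (profile_index k m.+1 x) =
    - Bmx R k m.+1 r (profile_index k m.+1 [ffun i => x (tperm ord0 t i)]).
Proof.
move=> t0; have [u [v [tE xE xE']]] := strategies_tperm k m x t t0.
apply: (Dblock_digits _ _ (x ord0) (x t) u v) => //=.
- by rewrite -[RHS](size_strategies k m.+1 x) xE.
- by have := strategies_lt k m.+1 x; rewrite xE.
- by rewrite xE.
- by rewrite -xE'; congr digits; apply: eq_map => i; rewrite ffunE.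
Qed.

(** * Entries of B and its values at the profiles (j, z^i) *)

(** The signed sum over permutations defining [eta] is the Leibniz expansion of this determinant. *)
Lemma Bmx_profile_index (R : realFieldType) (k m : nat) (x : profile m.+1 k) r :
  Bmx R k m.+1 r (profile_index k m.+1 x) =
    (x ord0 == (r %% k)%N :> nat)%:R *
    \det (\matrix_(i < m, j < m) (x (lift ord0 i) == nth 0 (ztuple k m.+1 (r %/ k)%N) j :> nat)%:R).
Proof.
have e : (k * k ^ m = k ^ m.+1)%N by rewrite expnS.
rewrite mxE (conform_mxE _ _ _ _ _ (erefl : 1 * 1 = 1)%N e) mxE mxE mxE /=.
have yl := profile_index_subproof k m (fun i => x (lift ord0 i)).
congr (_ * _).
  rewrite strategiesS digits_cons size_strategies.
  by rewrite divnMDl ?(leq_ltn_trans _ yl) // divn_small // addn0.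
rewrite summxE; apply: eq_bigr => s _; rewrite mxE; congr (_ * _).
transitivity (kronf R k (fun t => nth 0 (ztuple k m.+1 (r %/ k)%N) (s t))
    (profile_index k m (fun i => x (lift ord0 i))) 0).
  congr (kronf _ _ _ _ _); last by apply/val_inj.
  by apply/val_inj; rewrite /= strategiesS digits_cons size_strategies modnMDl modn_small.
by rewrite kronf_profile_index; apply: eq_bigr => i _; rewrite mxE.
Qed.

Definition opponents (k m : nat) (x : profile m.+1 k) : seq nat :=
  strategies k m (fun i => x (lift ord0 i)).

(* x is the profile (j, z^i), where r = i k + j. *)
Definition row_profile (k m : nat) (r : 'I_(k * ell k m.+1)) (x : profile m.+1 k) : bool :=
  (x ord0 == (r %% k)%N :> nat) && (opponents k m x == ztuple k m.+1 (r %/ k)).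

Lemma mem_ztuple (k m i : nat) :
  (i < ell k m.+1)%N -> ztuple k m.+1 i \in incr_seqs k m 0.
Proof. by move=> il; rewrite mem_nth // size_incr_seqs subn0. Qed.

Lemma ltn_row_divn (k l : nat) (r : 'I_(k * l)) : (r %/ k < l)%N.
Proof.
have kl : (0 < k * l)%N := leq_ltn_trans (leq0n _) (ltn_ord r).
by rewrite ltn_divLR ?(mulnC l) //; case: (k) kl.
Qed.

Lemma ltn_row_modn (k l : nat) (r : 'I_(k * l)) : (r %% k < k)%N.
Proof.
have kl : (0 < k * l)%N := leq_ltn_trans (leq0n _) (ltn_ord r).
by rewrite ltn_mod; case: (k) kl.
Qed.

Lemma row_profile_exists (k m : nat) (r : 'I_(k * ell k m.+1)) :
  exists x : profile m.+1 k, row_profile k m r x.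
Proof.
pose x0 : 'I_k := Ordinal (ltn_row_modn _ _ r).
set z := ztuple k m.+1 (r %/ k).
have := mem_ztuple k m _ (ltn_row_divn _ _ r).
rewrite -/z mem_incr_seqs => /and3P[/eqP sz _ /allP zk].
(* Player 0 plays [x0]. For the opponents, the default of [insubd] is never reached, as all entries
   of [z] are below [k]. *)
exists [ffun i => oapp (fun t : 'I_m => insubd x0 (nth 0%N z t)) x0 (unlift ord0 i)].
rewrite /row_profile ffunE unlift_none /= eqxx /=; apply/eqP.
apply: (@eq_from_nth _ 0%N) => [|i]; rewrite size_strategies ?sz // => im.
rewrite (nth_strategies _ _ _ (Ordinal im)) ffunE liftK /= insubdK //.
by rewrite -topredE /=; apply: (zk _ (mem_nth _ _)); rewrite sz.
Qed.

Lemma row_profile_inj (k m : nat) (r : 'I_(k * ell k m.+1)) (x y : profile m.+1 k) :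
  row_profile k m r x -> row_profile k m r y -> x = y.
Proof.
case/andP => /eqP x0 /eqP xr /andP[/eqP y0 /eqP yr]; apply/ffunP => i; apply/val_inj.
have [j ->|->] := unliftP ord0 i; last by rewrite /= x0 y0.
rewrite /= -(nth_strategies k m (fun i => x (lift ord0 i))) -/(opponents k m x) xr -yr.
by rewrite /opponents nth_strategies.
Qed.

Lemma row_profile_sorted (k m : nat) (x : profile m.+1 k) :
  sorted ltn (opponents k m x) ->
  exists r : 'I_(k * ell k m.+1), row_profile k m r x.
Proof.
move=> sx; set z := opponents k m x.
have zI : z \in incr_seqs k m 0.
  by rewrite mem_incr_seqs size_strategies eqxx sx; apply: strategies_lt.
have il : (index z (incr_seqs k m 0) < ell k m.+1)%N.
  by rewrite /ell /= -[X in 'C(X, _)]subn0 -size_incr_seqs index_mem.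
have rP : (x ord0 + index z (incr_seqs k m 0) * k < k * ell k m.+1)%N.
  by rewrite addnC (mulnC k); apply: mulD_lt.
exists (Ordinal rP); have k_gt0 : (0 < k)%N := leq_ltn_trans (leq0n _) (ltn_ord (x ord0)).
rewrite /row_profile /= addnC modnMDl divnMDl // modn_small // divn_small // addn0.
by rewrite /ztuple /= nth_index // !eqxx.
Qed.

(** If the two tuples agree, the matrix is the identity because their entries are distinct.
    Otherwise some entry of one is missing from the other, which gives a zero row. *)
Lemma Bmx_row_profile (R : realFieldType) (k m : nat) (r r' : 'I_(k * ell k m.+1))
    (x : profile m.+1 k) :
  row_profile k m r x -> Bmx R k m.+1 r' (profile_index k m.+1 x) = (r' == r)%:R.
Proof.
case/andP => /eqP x0 /eqP xr; rewrite Bmx_profile_index x0 /=.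
have := mem_ztuple k m _ (ltn_row_divn _ _ r).
have := mem_ztuple k m _ (ltn_row_divn _ _ r').
rewrite !mem_incr_seqs => /and3P[/eqP sz' z'_sorted _] /and3P[/eqP sz z_sorted _].
have uz := sorted_uniq ltn_trans ltnn z_sorted.
have [zr|zr] := eqVneq (ztuple k m.+1 (r' %/ k)) (ztuple k m.+1 (r %/ k)).
  set M := \matrix_(i, j) _.
  have -> : M = 1%:M.
    apply/matrixP => i j; rewrite !mxE zr -xr -(nth_strategies k m (fun i => x (lift ord0 i))).
    by rewrite nth_uniq ?size_strategies //; rewrite /opponents in xr; rewrite xr.
  rewrite det1 mulr1; congr (nat_of_bool _)%:R.
  have /eqP rr' : (r' %/ k == r %/ k)%N.
    by move/eqP: zr; rewrite /ztuple /= nth_uniq ?incr_seqs_uniq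
      ?size_incr_seqs ?subn0 ?ltn_row_divn.
  apply/eqP/eqP => [rm|-> //]; apply/val_inj.
  by rewrite /= (divn_eq r' k) (divn_eq r k) rr' rm.
(* Inclusion of one tuple in the other would force equality: both are strictly sorted and of the
   same size. *)
have [a az az'] : exists2 a, a \in ztuple k m.+1 (r %/ k) & a \notin ztuple k m.+1 (r' %/ k).
  apply/allPn; apply: contra zr => /allP sub; apply/eqP/esym.
  apply: (irr_sorted_eq ltn_trans ltnn) => //.
  by have [] := uniq_min_size uz sub; rewrite ?sz ?sz'.
have im : (index a (ztuple k m.+1 (r %/ k)) < m)%N by rewrite -[X in (_ < X)%N]sz index_mem.
have -> : (r' == r) = false by apply: contraNF zr => /eqP->.
rewrite /determinant big1 ?mulr0 // => s _.
rewrite (bigD1 (Ordinal im)) //= mxE -(nth_strategies k m (fun i => x (lift ord0 i))).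
rewrite -/(opponents k m x) xr /= nth_index //; case: eqP => [aE|]; last by rewrite mul0r mulr0.
by rewrite aE mem_nth ?sz' in az'.
Qed.

(** * Skew-symmetry of the rows of D *)

Lemma stab0_perm (m : nat) (q : 'S_m.+1) :
  q ord0 = ord0 -> exists q' : 'S_m, q = lift_perm ord0 ord0 q'.
Proof.
move=> q0.
have qN i : q (lift ord0 i) != ord0.
  by rewrite -{2}q0 (inj_eq perm_inj) eq_sym neq_lift.
pose f i := odflt i (unlift ord0 (q (lift ord0 i))).
have fP i : lift ord0 (f i) = q (lift ord0 i).
  by rewrite /f; case: unliftP (qN i) => [j -> //|->]; rewrite eqxx.
have f_inj : injective f.
  by move=> i j fij; apply/(@lift_inj _ ord0)/(@perm_inj _ q); rewrite -!fP fij.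
exists (perm f_inj); apply/permP => i.
have [j ->|->] := unliftP ord0 i; last by rewrite lift_perm_id.
by rewrite lift_perm_lift permE fP.
Qed.

Lemma Bmx_stab0 (R : realFieldType) (k m : nat) r (q : 'S_m.+1) (x : profile m.+1 k) :
  q ord0 = ord0 ->
  Bmx R k m.+1 r (profile_index k m.+1 [ffun i => x (q i)]) =
    (-1) ^+ q * Bmx R k m.+1 r (profile_index k m.+1 x).
Proof.
case/stab0_perm => q' ->; rewrite !Bmx_profile_index ffunE lift_perm_id odd_lift_perm /=.
(* Permuting the opponents permutes the rows of the determinant. *)
rewrite mulrCA -det_perm -det_mulmx -row_permE; congr (_ * \det _).
by apply/matrixP => i j; rewrite !mxE ffunE lift_perm_lift.
Qed.

(** Treats all blocks uniformly: [tperm ord0 i] is the identity for player 0 and odd for the others,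
    which accounts for the minus sign in D. *)
Lemma Dblock_tperm (R : realFieldType) (k m : nat) (x : profile m.+1 k) (i : 'I_m.+1) r :
  Dblock R k m.+1 i r (profile_index k m.+1 x) =
    (-1) ^+ tperm ord0 i * Bmx R k m.+1 r (profile_index k m.+1 [ffun t => x (tperm ord0 i t)]).
Proof.
rewrite odd_tperm; have [<-|i0] := eqVneq ord0 i;
  last by rewrite Dblock_profile_index ?mulN1r // eq_sym.
rewrite expr0 mul1r tperm1 (_ : [ffun t => _] = x) //.
by apply/ffunP => t; rewrite ffunE perm1.
Qed.

Lemma Dblock_skew (R : realFieldType) (k m : nat) r :
  skew_symmetric (fun i (x : profile m.+1 k) => Dblock R k m.+1 i r (profile_index k m.+1 x)).
Proof.
move=> s i x; rewrite !Dblock_tperm.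
(* Products act from left to right, so 0 goes to [s i], then to [i], then back to 0. Hence
   [Bmx_stab0] applies to [q], and the signs of its two transpositions and of [s] cancel those in
   the claim. *)
pose q := (tperm ord0 (s i) * s^-1 * tperm ord0 i)%g.
have q0 : q ord0 = ord0 by rewrite !permM tpermL permK tpermR.
have -> : [ffun t => [ffun t => x ((s^-1)%g t)] (tperm ord0 (s i) t)] =
    [ffun t => [ffun t => x (tperm ord0 i t)] (q t)].
  by apply/ffunP => t; rewrite !ffunE !permM tpermK.
rewrite (Bmx_stab0 _ _ _ _ q) // !mulrA -!signr_addb; congr (_ ^+ nat_of_bool _ * _).
by rewrite !odd_permM odd_permV; do 3 case: odd_perm.
Qed.

(** * A vanishing criterion for skew-symmetric games *)

Lemma skew_symmetric_eq0 (R : realFieldType) (k m : nat) (c : 'I_m.+1 -> profile m.+1 k -> R) :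
  skew_symmetric c ->
  (forall x, sorted ltn (opponents k m x) -> c ord0 x = 0) ->
  forall i x, c i x = 0.
Proof.
move=> cS c0.
suff c00 x : c ord0 x = 0 by move=> i x; rewrite (cS (tperm i ord0)) tpermL c00 mulr0.
have [/injectiveP x_inj|] := boolP (injectiveb (fun i => x (lift ord0 i))).
  pose S := [tuple (x (lift ord0 i) : nat) | i < m].
  have Su : uniq S.
    by rewrite map_inj_uniq ?val_ord_tuple ?enum_uniq // => i j /val_inj/x_inj.
  have /tuple_permP[p Sp] : perm_eq (sort leq S) S by rewrite perm_sort.
  (* This permutation fixes player 0 and sorts the opponents' strategies, strictly since they are
     distinct. *)
  pose q := lift_perm ord0 ord0 p.
  rewrite (cS (q^-1)%g) lift_permV lift_perm_id c0 ?mulr0 //.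
  set y := [ffun _ => _].
  have -> : opponents k m y = sort leq S.
    rewrite Sp; apply: eq_map => i.
    by rewrite ffunE -lift_permV invgK lift_perm_lift tnth_mktuple.
  by rewrite ltn_sorted_uniq_leq sort_uniq Su sort_sorted //; apply: leq_total.
case/injectivePn => a [b ab xab].
pose s := tperm (lift ord0 a) (lift ord0 b).
(* Exchanging two opponents with equal strategies fixes [x], so the payoff equals its own negative
   and vanishes in characteristic 0. *)
have := cS s ord0 x; rewrite odd_tperm (inj_eq lift_inj) ab.
rewrite tpermD 1?eq_sym ?neq_lift //.
have -> : [ffun t => x ((s^-1)%g t)] = x.
  apply/ffunP => t; rewrite ffunE tpermV; case: tpermP => // ->; by rewrite xab.
by move=> /eqP; rewrite expr1 mulN1r -addr_eq0 -mulr2n mulrn_eq0 => /eqP.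
Qed.

(** * Structure vectors, combinations of rows, and the basis property *)

Lemma eq_rV_profile_index (R : realFieldType) (k m : nat) (v w : 'rV[R]_(m * k ^ m)) :
  (forall i (x : profile m k),
     v 0 (mxtens_index (i, profile_index k m x)) = w 0 (mxtens_index (i, profile_index k m x))) ->
  v = w.
Proof.
move=> vw; apply/rowP => j; case: (mxtens_indexP j) => i c.
by have [x ->] := profile_index_surj k m c.
Qed.

Lemma inK_skew (R : realFieldType) (k m : nat) (v : 'rV[R]_(m * k ^ m)) :
  inK v <-> skew_symmetric (fun i (x : profile m k) => v 0 (mxtens_index (i, profile_index k m x))).
Proof.
have VE (c : 'I_m -> profile m k -> R) i (x : profile m k) :
    Vgame c 0 (mxtens_index (i, profile_index k m x)) = c i x.
  by rewrite mxE mxtens_indexK Vpay_profile_index.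
split=> [[c [cS ->]] s i x|vS]; first by rewrite !VE.
exists (fun i (x : profile m k) => v 0 (mxtens_index (i, profile_index k m x))); split=> //.
by apply: eq_rV_profile_index => i x; rewrite VE.
Qed.

Lemma mulDmx_profile_index (R : realFieldType) (k m : nat) (a : 'rV[R]_(k * ell k m)) i
    (x : profile m k) :
  (a *m Dmx R k m) 0 (mxtens_index (i, profile_index k m x)) =
    \sum_r a 0 r * Dblock R k m i r (profile_index k m x).
Proof. by rewrite mxE; apply: eq_bigr => r _; rewrite mxE mxtens_indexK. Qed.

(** Block 0 of D is B, so player 0's payoff at (j, z^i) reads off one coefficient. This yields
    independence and also dictates the coefficients for spanning. *)
Lemma mulDmx_row_profile (R : realFieldType) (k m : nat) (a : 'rV[R]_(k * ell k m.+1)) r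
    (x : profile m.+1 k) :
  row_profile k m r x ->
  (a *m Dmx R k m.+1) 0 (mxtens_index (ord0, profile_index k m.+1 x)) = a 0 r.
Proof.
move=> rx; rewrite mulDmx_profile_index (bigD1 r) //= big1 => [|r' r'r].
  by rewrite /Dblock /= (Bmx_row_profile _ _ _ r) // eqxx mulr1 addr0.
by rewrite /Dblock /= (Bmx_row_profile _ _ _ r) // (negPf r'r) mulr0.
Qed.

Lemma mulDmx_skew (R : realFieldType) (k m : nat) (a : 'rV[R]_(k * ell k m.+1)) :
  skew_symmetric (fun i (x : profile m.+1 k) =>
    (a *m Dmx R k m.+1) 0 (mxtens_index (i, profile_index k m.+1 x))).
Proof.
move=> s i x; rewrite !mulDmx_profile_index mulr_sumr; apply: eq_bigr => r _.
by rewrite (Dblock_skew R k m r s i x) mulrCA.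
Qed.

Theorem theorem4p5 (R : realFieldType) (k n : nat) :
  (2 <= n)%N -> (n <= k.+1)%N ->
  row_free (Dmx R k n) /\
  (forall v : 'rV[R]_(n * k ^ n), (v <= Dmx R k n)%MS <-> inK v).
Proof.
case: n => // m _ _; split=> [|v].
  apply: inj_row_free => v vD; apply/rowP => r; have [x rx] := row_profile_exists k m r.
  by rewrite -(mulDmx_row_profile R k m v r x rx) vD !mxE.
rewrite inK_skew; split=> [/submxP[a ->]|vS]; first exact: mulDmx_skew.
pose p r := xchoose (row_profile_exists k m r).
(* The only possible coefficients: player 0's payoffs in [v] at the profiles (j, z^i). *)
apply/submxP; exists (\row_r v 0 (mxtens_index (ord0, profile_index k m.+1 (p r)))).
set a := \row_r _; apply/eqP; rewrite -subr_eq0; apply/eqP.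
apply: eq_rV_profile_index => i x; rewrite [RHS]mxE.
pose c i (x : profile m.+1 k) :=
  (v - a *m Dmx R k m.+1) 0 (mxtens_index (i, profile_index k m.+1 x)).
have cE j y : c j y = v 0 (mxtens_index (j, profile_index k m.+1 y))
    - (a *m Dmx R k m.+1) 0 (mxtens_index (j, profile_index k m.+1 y)).
  by rewrite /c mxE [X in _ + X]mxE.
(* The difference [c] is skew-symmetric, and a profile with sorted opponents is the one chosen by
   [p] for some row, where [c] vanishes for player 0. *)
apply: (skew_symmetric_eq0 R k m c) => [s j y|y /row_profile_sorted[r ry]].
  by rewrite !cE mulrBr -vS -(mulDmx_skew _ _ _ _ s).
rewrite cE (mulDmx_row_profile _ _ _ _ r) // mxE.
have -> : p r = y.
  exact: row_profile_inj (xchooseP (row_profile_exists k m r)) ry.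
by rewrite subrr.
Qed.
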